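(* Let $n\equiv 1\pmod 4$ be a positive integer and let $a$ be an indeterminate. Then, modulo $[n](1-aq^n)(a-q^n)$, \[ \sum_{k=0}^{(n-1)/4}[8k+1]\frac{(q;q^4)_k^2(aq;q^4)_k(q/a;q^4)_k}{(q^4;q^4)_k^2(aq^4;q^4)_k(q^4/a;q^4)_k}q^{2k}\equiv \frac{(q^2;q^4)_{(n-1)/4}}{(q^4;q^4)_{(n-1)/4}}[n]\,q^{(1-n)/4}. \]
   Context: For an indeterminate $q$, $(x;q)_k=(1-x)(1-xq)\cdots(1-xq^{k-1})$ (with $(x;q)_0=1$). For an integer $m$, $[m]=(1-q^m)/(1-q)$. A congruence $A\equiv B\pmod{P}$ between rational functions in $q$ and $a$ means that $A-B$, written as a quotient of polynomials with denominator coprime to $P$, has numerator divisible by $P$ (in the polynomial ring in $q,a$). *)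

(* Defs.v *)
From HB Require Import structures.
From mathcomp Require Import all_boot all_order all_algebra.
Set Implicit Arguments. Unset Strict Implicit. Unset Printing Implicit Defensive.
Import Order.TTheory GRing.Theory Num.Theory.
Local Open Scope ring_scope.

Definition toF (x : {poly {poly rat}}) : {fraction {poly {poly rat}}} :=
  FracField.tofrac x.

Definition qP : {poly {poly rat}} := ('X : {poly rat})%:P.
Definition aP : {poly {poly rat}} := 'X.
Definition qF : {fraction {poly {poly rat}}} := toF qP.
Definition aF : {fraction {poly {poly rat}}} := toF aP.

Definition qpoch (x y : {fraction {poly {poly rat}}}) (k : nat)
  : {fraction {poly {poly rat}}} := \prod_(i < k) (1 - x * y ^+ i).

Definition qint (m : nat) : {fraction {poly {poly rat}}} :=
  (1 - qF ^+ m) / (1 - qF).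

Definition dvdR (P N : {poly {poly rat}}) : Prop :=
  exists M : {poly {poly rat}}, N = P * M.

Definition coprimeR (D P : {poly {poly rat}}) : Prop :=
  forall c : {poly {poly rat}}, dvdR c D -> dvdR c P -> c \is a GRing.unit.

Definition congr_mod (A B : {fraction {poly {poly rat}}})
  (P : {poly {poly rat}}) : Prop :=
  exists N D : {poly {poly rat}},
    D != 0 /\ coprimeR D P /\ A - B = toF N / toF D /\ dvdR P N.

(* Main.v *)
(** Write n = 4m + 1 and clear denominators, so that the difference of the two
    sides has a numerator in Q[q][a].  The three factors of the modulus are
    treated separately: two linear ones by specializing a, the third by
    specializing q.
    - At a = q^n or a = q^(-n) the sum is a terminating very-well-poised 6phi5
      series in base q^4, and the two sides agree exactly; the summation is a
      Wilf-Zeilberger telescoping in m.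
    - For [n], evaluate q at a root of unity z of order d dividing n.  With
      r = m mod d one has z^(4r+1) = 1, the substitution k -> r - k changes the
      sign of the summand, and the summand vanishes for r < k < d.  The range
      0..m consists of full blocks of length d and a last block 0..r, so the
      sum is zero.

    The coefficients (q;q^4)_k / (q^4;q^4)_k have no pole at such z: since
    4(3m+i+1) = 3n + (4i+1), they agree with the Gaussian binomial
    [k+3m choose k] in base q^4 up to a factor without zero or pole at z.
    Similarly (q^2;q^4)_m / (q^4;q^4)_m is the central Gaussian binomial
    [2m choose m] in base q^2 divided by the square of (-q^2;q^2)_m. *)
Require Import Defs.
From HB Require Import structures.
From mathcomp Require Import all_boot all_order all_algebra all_field.
From mathcomp Require Import ring lra zify.
Set Implicit Arguments. Unset Strict Implicit. Unset Printing Implicit Defensive.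
Import Order.TTheory GRing.Theory Num.Theory.
Local Open Scope ring_scope.

Ltac neq0_up_to_ring := match goal with
  | H : is_true (?b != 0) |- is_true (?a != 0) =>
      first [exact: H | (have -> : a = b by ring); exact: H
            | (have -> : a = - b by ring); rewrite oppr_eq0; exact: H]
  end.
Ltac split_neq0 := repeat (apply/andP; split); neq0_up_to_ring.

(** Equals a (1 - a q^j)(1 - q^j / a), cleared of 1/a. With j = n it is the part of the modulus that
    involves [a]. *)
Definition pole (R : nzRingType) (q a : R) j := (1 - a * q ^+ j) * (a - q ^+ j).

(** * The summand as a well-poised product *)

Section WellPoised.
Variable K : fieldType.
Implicit Types (q a : K) (i k m : nat).

(* Quotient of consecutive summands of the theorem, without the factor [8k+1]. *)
Definition wp_ratio q a i :=
  q ^+ 2 * ((1 - q ^+ (4 * i + 1)) ^+ 2 * (1 - a * q ^+ (4 * i + 1)) * (a - q ^+ (4 * i + 1)))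
  / ((1 - q ^+ (4 * i + 4)) ^+ 2 * (1 - a * q ^+ (4 * i + 4)) * (a - q ^+ (4 * i + 4))).

Definition wp_term q a k := (1 - q ^+ (8 * k + 1)) * \prod_(i < k) wp_ratio q a i.

Definition wp_sum q a m := \sum_(k < m.+1) wp_term q a k.

Lemma wp_prodE q a k :
  \prod_(i < k) wp_ratio q a i = q ^+ (2 * k) *
    (\prod_(i < k) (1 - q ^+ (4 * i + 1)) / \prod_(i < k) (1 - q ^+ (4 * i + 4))) ^+ 2
    * \prod_(i < k) (pole q a (4 * i + 1) / pole q a (4 * i + 4)).
Proof.
rewrite -!prodfV -!big_split /= -prodrXl exprM -[in q ^+ 2 ^+ k](card_ord k) -prodr_const.
rewrite -!big_split; apply: eq_bigr => i _; rewrite /= /wp_ratio /pole.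
rewrite expr_div_n !invfM; move: ((1 - q ^+ (4 * i + 4))^-1) => u.
by move: ((1 - a * _)^-1) ((a - q ^+ (4 * i + 4))^-1) => x y; ring.
Qed.

(** Inverting [a] multiplies each pair (1 - a u)(a - u) by a^-2, which cancels in the quotient. This
    reduces a = q^(-n) to a = q^n. *)
Lemma wp_ratioV q a i : a != 0 -> wp_ratio q a^-1 i = wp_ratio q a i.
Proof.
move=> a0; rewrite /wp_ratio; set x := q ^+ _; set y := q ^+ _.
have sym u : (1 - a^-1 * u) * (a^-1 - u) = a ^- 2 * ((1 - a * u) * (a - u)) by field.
rewrite -!(mulrA ((1 - _) ^+ 2)) !sym !(mulrCA _ (a ^- 2)) -mulf_div divff ?mul1r //.
by rewrite invr_neq0 // expf_neq0.
Qed.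

Lemma wp_sumV q a m : a != 0 -> wp_sum q a^-1 m = wp_sum q a m.
Proof.
move=> a0; apply: eq_bigr => k _; congr (_ * _).
by apply: eq_bigr => i _; rewrite wp_ratioV.
Qed.

End WellPoised.

(** * Exact summation at a = q^(4m+1) *)

Section SixPhiFive.
Variables (K : fieldType) (q : K).
Hypothesis q0 : q != 0.
Hypothesis q_free : forall i, (0 < i)%N -> q ^+ i != 1.

Lemma subr_expr_neq0 i j : i != j -> q ^+ i - q ^+ j != 0.
Proof.
wlog lt_ij : i j / (i < j)%N => [IH ne_ij | _].
  have /orP[lt_ij | lt_ji] : (i < j)%N || (j < i)%N by rewrite -neq_ltn.
    exact: IH.
  by rewrite -opprB oppr_eq0 IH // eq_sym.
rewrite -(subnKC (ltnW lt_ij)) exprD -{1}[q ^+ i]mulr1 -mulrBr mulf_neq0 ?expf_neq0 //.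
by rewrite subr_eq0 eq_sym q_free // subn_gt0.
Qed.

Lemma subr1_expr_neq0 i : (0 < i)%N -> 1 - q ^+ i != 0.
Proof. by move=> i0; rewrite -(expr0 q) subr_expr_neq0 // eq_sym -lt0n. Qed.

(** The right-hand side of the theorem for n = 4m + 1, times 1 - q. *)
Definition wp_closed m :=
  (1 - q ^+ (4 * m + 1))
  * (\prod_(i < m) (1 - q ^+ (4 * i + 2)) / \prod_(i < m) (1 - q ^+ (4 * i + 4))) / q ^+ m.

Let wp_prod m k := \prod_(i < k) wp_ratio q (q ^+ (4 * m + 1)) i.
(* Equals [wp_closed m / wp_closed m.+1]. *)
Let closed_ratio m := q * (1 - q ^+ (4 * m + 1)) * (1 - q ^+ (4 * m + 4))
  / ((1 - q ^+ (4 * m + 5)) * (1 - q ^+ (4 * m + 2))).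

Lemma wp_closedS m : closed_ratio m * wp_closed m.+1 = wp_closed m.
Proof.
rewrite /wp_closed !big_ord_recr /= exprS /closed_ratio.
have -> : (4 * m.+1 + 1 = 4 * m + 5)%N by lia.
have h1 := @subr1_expr_neq0 (4 * m + 5).
have h2 := @subr1_expr_neq0 (4 * m + 2).
have h3 := @subr1_expr_neq0 (4 * m + 4).
have h4 : \prod_(i < m) (1 - q ^+ (4 * i + 4)) != 0.
  by apply/prodf_neq0 => i _; apply: subr1_expr_neq0; lia.
have h5 : q ^+ m != 0 by rewrite expf_neq0.
field; rewrite q0 h5 h4 h1 ?h2 ?h3 //; lia.
Qed.

(** In terms of x = q^(4k) and y = q^(4m) the identities below become rational-function identities
    within reach of [field]. *)
Lemma wp_ratio_specE m k : let x := q ^+ (4 * k) in let y := q ^+ (4 * m) in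
  wp_ratio q (q ^+ (4 * m + 1)) k =
    q ^+ 2 * ((1 - x * q) ^+ 2 * (1 - y * q * (x * q)) * (y * q - x * q))
    / ((1 - x * q ^+ 4) ^+ 2 * (1 - y * q * (x * q ^+ 4)) * (y * q - x * q ^+ 4)).
Proof. by rewrite /wp_ratio !exprD !expr1. Qed.

(** The denominators met by [field] below. The bound on k matters for y q^4 - x, which vanishes at k
    = m + 1. *)
Lemma wp_ratio_denoms m k : let x := q ^+ (4 * k) in let y := q ^+ (4 * m) in
  (k <= m)%N ->
  [/\ 1 - x * q ^+ 4 != 0, 1 - y * q * (x * q ^+ 4) != 0, y * q - x * q ^+ 4 != 0,
      1 - y * q ^+ 2 != 0 & [/\ 1 - y * q ^+ 4 != 0, 1 - y * q ^+ 5 != 0, 1 - y * q != 0,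
      y * q ^+ 4 - x != 0 & y * q - x != 0]].
Proof.
move=> x y km; rewrite /x /y mulrAC -exprD -mulrA -exprSr -!exprD -!exprSr -!exprD.
by split; last split; (apply: subr1_expr_neq0 || apply: subr_expr_neq0); lia.
Qed.

Lemma exprS4 m : q ^+ (4 * m.+1) = q ^+ (4 * m) * q ^+ 4.
Proof. by rewrite mulnS addnC exprD. Qed.

(** Passing from m to m + 1 multiplies a by the base q^4, so the shifted factorials move by one step
    and only boundary factors remain. *)
Lemma wp_prod_shift m k : (k <= m)%N -> let x := q ^+ (4 * k) in let y := q ^+ (4 * m) in
  wp_prod m.+1 k = wp_prod m k * ((1 - y * q ^+ 4) * (y * q - x) * (1 - x * y * q ^+ 2) * (1 - y * q ^+ 5))
    / ((y * q ^+ 4 - x) * (1 - y * q) * (1 - y * q ^+ 2) * (1 - x * y * q ^+ 5)).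
Proof.
elim: k => [_|k IH km] /=.
  have := @wp_ratio_denoms m 0 isT; rewrite /wp_prod !big_ord0 muln0 expr0.
  move: (q ^+ (4 * m)) => y [_ _ _ h4 [h5 h6 h7 h8 h9]].
  by field; split_neq0.
rewrite {1}/wp_prod [wp_prod m k.+1]/wp_prod !big_ord_recr /= -!/(wp_prod _ k) IH; last exact: ltnW.
have := @wp_ratio_denoms m k (ltnW km); have := @wp_ratio_denoms m k.+1 km.
have := @wp_ratio_denoms m.+1 k (leqW (ltnW km)).
rewrite !wp_ratio_specE !exprS4.
move: (wp_prod m k) (q ^+ (4 * m)) (q ^+ (4 * k)) => p y x /=.
move=> [_ g2 g3 g4 [g5 g6 g7 g8 g9]].
move=> [h1 h2 h3 h4 [h5 h6 h7 h8 h9]] [f1 f2 f3 f4 [f5 f6 f7 f8 f9]].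
by field; split_neq0.
Qed.

(* The right-hand side is the WZ certificate; multiplying by [wp_prod] keeps it
   free of the pole at [k = m.+1]. *)
Lemma wp_partial_sums m k : (k <= m)%N -> let x := q ^+ (4 * k) in let y := q ^+ (4 * m) in
  closed_ratio m * (\sum_(j < k.+1) wp_term q (q ^+ (4 * m.+1 + 1)) j)
  - \sum_(j < k.+1) wp_term q (q ^+ (4 * m + 1)) j =
  - wp_prod m k * ((1 - y ^+ 2 * q ^+ 6) * (1 - x * q) ^+ 2 * (1 - x * y * q ^+ 2))
    / ((1 - y * q ^+ 2) ^+ 2 * (1 - x * y * q ^+ 5)).
Proof.
elim: k => [_|k IH km] /=.
  have := @wp_ratio_denoms m 0 isT; rewrite !big_ord1 /wp_term !big_ord0 /wp_prod !big_ord0 muln0 expr0.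
  rewrite /closed_ratio !exprD; move: (q ^+ (4 * m)) => y [_ _ _ h4 [h5 h6 h7 h8 h9]].
  by field; split_neq0.
rewrite big_ord_recr [in X in _ - X]big_ord_recr /= mulrDr opprD addrACA IH ?(ltnW km) //.
rewrite /wp_term -!/(wp_prod _ _) wp_prod_shift //.
rewrite [wp_prod m k.+1]/wp_prod big_ord_recr /= -/(wp_prod m k).
have := @wp_ratio_denoms m k (ltnW km); have := @wp_ratio_denoms m k.+1 km.
have -> : (8 * k.+1 + 1 = 4 * k + 4 * k + 9)%N by lia.
rewrite /closed_ratio !wp_ratio_specE !exprS4 !exprD.
move: (wp_prod m k) (q ^+ (4 * m)) (q ^+ (4 * k)) => p y x /=.
move=> [h1 h2 h3 h4 [h5 h6 h7 h8 h9]] [f1 f2 f3 f4 [f5 f6 f7 f8 f9]].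
by field; split_neq0.
Qed.

(** Induction on m. At k = m the partial sums differ by the certificate, which the one extra summand
    k = m + 1 of the longer series cancels. *)
Lemma wp_sum_closed m : wp_sum q (q ^+ (4 * m + 1)) m = wp_closed m.
Proof.
elim: m => [|m IH].
  rewrite /wp_sum big_ord1 /wp_term /wp_closed !big_ord0 muln0 expr0; field.
  by rewrite oner_neq0.
have ratio0 : closed_ratio m != 0.
  by rewrite /closed_ratio ?mulf_neq0 ?invr_eq0 ?mulf_neq0 // subr1_expr_neq0 //; lia.
apply: (mulfI ratio0); rewrite wp_closedS -IH /wp_sum big_ord_recr /= mulrDr.
apply/eqP; rewrite -subr_eq0 addrAC wp_partial_sums // addrC addr_eq0; apply/eqP.
rewrite /wp_term -/(wp_prod _ _) [wp_prod m.+1 m.+1]/wp_prod big_ord_recr /= -/(wp_prod m.+1 m) wp_prod_shift //.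
have := @wp_ratio_denoms m m (leqnn m); have := @wp_ratio_denoms m.+1 m (leqnSn m).
have -> : (8 * m.+1 + 1 = 4 * m + 4 * m + 9)%N by lia.
rewrite /closed_ratio !wp_ratio_specE !exprS4 !exprD.
move: (wp_prod m m) (q ^+ (4 * m)) => p y /=.
move=> [h1 h2 h3 h4 [h5 h6 h7 h8 h9]] [f1 f2 f3 f4 [f5 f6 f7 f8 f9]].
by field; split_neq0.
Qed.

End SixPhiFive.

(** * Vanishing of the sum at roots of unity *)

Lemma prodr_blocks (R : comNzRingType) (f : nat -> R) l d j :
  (forall i, f (i + d)%N = f i) ->
  \prod_(i < l * d + j) f i = \prod_(i < l * d) f i * \prod_(i < j) f i.
Proof.
move=> per; rewrite big_split_ord /=; congr (_ * _); apply: eq_bigr => i _.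
elim: l => [|l IH] //; rewrite mulSn -addnA addnC per; exact: IH.
Qed.

Lemma sumr_blocks (V : zmodType) (f : nat -> V) l d j :
  \sum_(k < l * d + j) f k =
  \sum_(b < l) \sum_(i < d) f (b * d + i)%N + \sum_(i < j) f (l * d + i)%N.
Proof.
rewrite big_split_ord /=; congr (_ + _).
elim: l => [|l IH]; first by rewrite !big_ord0.
by rewrite mulSn addnC big_split_ord /= IH big_ord_recr.
Qed.

Section RootOfUnity.
Variables (K : fieldType) (z a : K) (d : nat).
Hypothesis z_prim : d.-primitive_root z.
Hypothesis a_gen : forall i, a * z ^+ i != 1.
Hypothesis a_gen' : forall i, a != z ^+ i.
Hypothesis K2 : 2%:R != 0 :> K.

Let h (x : K) := (1 - x) ^+ 2 * (1 - a * x) * (a - x).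

Lemma h_neq0 i : ~~ (d %| i)%N -> h (z ^+ i) != 0.
Proof.
rewrite (prim_order_dvd z_prim) => zi1.
by rewrite !mulf_neq0 ?expf_neq0 ?subr_eq0 // eq_sym.
Qed.

(** As a polynomial of degree 4, [h] has palindromic coefficients; this is the well-poised structure
    behind the reflection. *)
Lemma h_recip x y : x * y = 1 -> h x = x ^+ 4 * h y.
Proof.
move=> xy; have x0 : x != 0 by apply: contra_eq_neq xy => ->; rewrite mul0r eq_sym oner_neq0.
have -> : y = x^-1 by rewrite -[LHS](mulKf x0) xy mulr1.
by rewrite /h; field.
Qed.

Lemma wp_ratioE i : wp_ratio z a i = z ^+ 2 * h (z ^+ (4 * i + 1)) / h (z ^+ (4 * i + 4)).
Proof. by []. Qed.

Section Reflection.
Variable r : nat.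
Hypothesis r_dvd : (d %| 4 * r + 1)%N.
Hypothesis r_lt : (r < d)%N.

Lemma expr_period : z ^+ (4 * r + 1) = 1.
Proof. by apply/eqP; rewrite -(prim_order_dvd z_prim). Qed.

Lemma expr_complement i j : (i + j = 4 * r + 1)%N -> z ^+ i * z ^+ j = 1.
Proof. by move=> ij; rewrite -exprD ij expr_period. Qed.

Lemma order_coprime4 : coprime d 4.
Proof.
by apply: coprime_dvdl r_dvd _; apply: coprime_dvdr (dvdn_mulr r (dvdnn 4)) _; rewrite addn1 coprimeSn.
Qed.

Lemma order_ndvd i : (i < r)%N -> ~~ (d %| 4 * i + 4)%N.
Proof.
move=> ir; by rewrite -mulnSr Gauss_dvdr ?order_coprime4 // gtnNdvd // (leq_ltn_trans _ r_lt).
Qed.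

(** The numerator exponent of each factor and the denominator exponent of the other add up to 4r +
    1, so [h_recip] cancels them crosswise. *)
Lemma wp_ratio_reflect i : (i < r)%N ->
  wp_ratio z a (r - i.+1) * wp_ratio z a i * z ^+ 8 = 1.
Proof.
move=> ir; have hi := h_neq0 (order_ndvd ir).
have hj : h (z ^+ (4 * (r - i.+1) + 4)) != 0 by apply/h_neq0/order_ndvd; lia.
rewrite !wp_ratioE.
have s1 : (4 * (r - i.+1) + 1 + (4 * i + 4) = 4 * r + 1)%N by lia.
have s2 : (4 * i + 1 + (4 * (r - i.+1) + 4) = 4 * r + 1)%N by lia.
have e1 := h_recip (expr_complement s1); have e2 := h_recip (expr_complement s2).
have e3 := expr_complement s1.
rewrite e1 e2; move: hi hj; set u := h (z ^+ (4 * i + 4)); set v := h _ => u0 v0.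
(* The powers z^2 z^2 z^8 combine to (z^3)^4, and z^3 turns the exponent 4i + 1 into 4i + 4. *)
have -> : z ^+ 2 * (z ^+ (4 * (r - i.+1) + 1) ^+ 4 * u) / v *
   (z ^+ 2 * (z ^+ (4 * i + 1) ^+ 4 * v) / u) * z ^+ 8 =
   (z ^+ (4 * (r - i.+1) + 1) * (z ^+ (4 * i + 1) * z ^+ 3)) ^+ 4 * (u / u) * (v / v).
  by field; split_neq0.
by rewrite !divff // -exprD -addnA e3 expr1n !mulr1.
Qed.

(** The case j = 0 of the reflection: taken in reverse order, the numerators are the denominators up
    to powers of z. *)
Lemma wp_prod_full : \prod_(i < r) wp_ratio z a i = z.
Proof.
have step : \prod_(i < r) wp_ratio z a i = \prod_(i < r) z ^+ 2 * \prod_(i < r) h (z ^+ (4 * i + 1))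
    / \prod_(i < r) h (z ^+ (4 * i + 4)).
  by rewrite -big_split /= -prodfV -big_split.
have refl : \prod_(i < r) h (z ^+ (4 * i + 1)) * \prod_(i < r) z ^+ (4 * (4 * i + 4))
    = \prod_(i < r) h (z ^+ (4 * i + 4)).
  rewrite (reindex_inj rev_ord_inj) /= -big_split; apply: eq_bigr => i _ /=; have ir := ltn_ord i.
  rewrite (@h_recip _ (z ^+ (4 * i + 4))); last by apply: expr_complement; lia.
  rewrite mulrAC -exprM -exprD.
  have -> : (((4 * (r - i.+1) + 1) * 4) + 4 * (4 * i + 4) = (4 * r + 1) * 4)%N by lia.
  by rewrite exprM expr_period expr1n mul1r.
have H0 : \prod_(i < r) h (z ^+ (4 * i + 4)) != 0.
  by apply/prodf_neq0 => i _; apply/h_neq0/order_ndvd.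
(* Direct evaluation: reflection alone fixes the product only up to sign. *)
have Hz : \prod_(i < r) z ^+ 2 = z * \prod_(i < r) z ^+ (4 * (4 * i + 4)).
  rewrite !prodrXr -exprS.
  have -> : (\sum_(i < r) 4 * (4 * i + 4) = 8 * r * r + 8 * r)%N.
    by elim: (r) => [|s IH]; rewrite ?big_ord0 // big_ord_recr /= IH; lia.
  rewrite sum_nat_const card_ord.
  have -> : ((8 * r * r + 8 * r).+1 = r * 2 + (4 * r + 1) * (2 * r + 1))%N by lia.
  by rewrite exprD [z ^+ ((4 * r + 1) * _)]exprM expr_period expr1n mulr1 mulnC exprM.
by rewrite step Hz -(mulrA z) (mulrC (\prod_(i < r) z ^+ _)) refl mulfK.
Qed.

(** Starting from the full product, each step trades the last factor on the left for a new one on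
    the right at the cost of z^8. *)
Lemma wp_prod_reflect j : (j <= r)%N ->
  \prod_(i < r - j) wp_ratio z a i = z ^+ (8 * j + 1) * \prod_(i < j) wp_ratio z a i.
Proof.
elim: j => [|j IH] jr; first by rewrite subn0 wp_prod_full big_ord0 mulr1.
have := IH (ltnW jr); rewrite big_ord_recr /= -[(r - j)%N](@subnSK) // big_ord_recr /=.
move: (wp_ratio_reflect jr); rewrite (_ : 8 * j.+1 + 1 = 8 * j + 1 + 8)%N; last by lia.
move: (\prod_(i < r - j.+1) _) (\prod_(i < j) _) (wp_ratio z a (r - j.+1)) (wp_ratio z a j).
move=> A B x y xy1 Ax; transitivity (A * (x * y * z ^+ 8)); first by rewrite xy1 mulr1.
by rewrite !mulrA Ax [z ^+ (_ + 8)]exprD; ring.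
Qed.

(** With Z = z^(8j+1), the reflected factor is 1 - Z^-1 and the product contributes Z; since (1 -
    Z^-1) Z = -(1 - Z), the sum is its own negative. *)
Lemma wp_sum_reflect : wp_sum z a r = 0.
Proof.
have E : wp_sum z a r = - wp_sum z a r.
  rewrite /wp_sum {1}(reindex_inj rev_ord_inj) /= -sumrN; apply: eq_bigr => j _.
  have jr : (j <= r)%N by rewrite -ltnS.
  rewrite /wp_term subSS wp_prod_reflect // mulrA -mulNr; congr (_ * _).
  rewrite mulrBl mul1r -exprD opprB.
  have -> : (8 * (r - j) + 1 + (8 * j + 1) = (4 * r + 1) * 2)%N by lia.
  by rewrite exprM expr_period expr1n.
have : wp_sum z a r * 2%:R = 0 by rewrite mulr_natr mulr2n {1}E addNr.
by move/eqP; rewrite mulf_eq0 (negPf K2) orbF => /eqP.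
Qed.

(** The factor i = r contains 1 - z^(4r+1) = 0. *)
Lemma wp_term_gt j : (r < j)%N -> wp_term z a j = 0.
Proof.
move=> rj; rewrite /wp_term (bigD1 (Ordinal rj)) //= wp_ratioE /h.
by rewrite expr_period subrr expr0n /= !(mul0r, mulr0).
Qed.

End Reflection.

(** Here [v k] stands for (q;q^4)_k / (q^4;q^4)_k up to a common factor. Both products may vanish at
    z, so the hypothesis compares [v] only with its value at the start of a block, where no
    denominator vanishes. *)
Lemma weighted_sum_eq0 m (v : nat -> K) :
  (d %| 4 * m + 1)%N ->
  (forall l j, (j < d)%N -> (l * d + j <= m)%N ->
     v (l * d + j)%N * \prod_(i < j) (1 - z ^+ (4 * i + 4))
     = v (l * d)%N * \prod_(i < j) (1 - z ^+ (4 * i + 1))) ->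
  \sum_(k < m.+1) (1 - z ^+ (8 * k + 1)) * v k ^+ 2 * z ^+ (2 * k)
     * \prod_(i < k) (pole z a (4 * i + 1) / pole z a (4 * i + 4)) = 0.
Proof.
move=> d_dvd vE.
have d_gt0 := prim_order_gt0 z_prim.
pose r := (m %% d)%N; pose L := (m %/ d)%N.
have mE : (m = L * d + r)%N by apply: divn_eq.
have r_lt : (r < d)%N by rewrite ltn_mod.
have r_dvd : (d %| 4 * r + 1)%N.
  move: d_dvd; rewrite mE mulnDr mulnA -addnA dvdn_addr //; exact: dvdn_mull.
pose g i := pole z a (4 * i + 1) / pole z a (4 * i + 4).
have zper c i j : z ^+ (4 * (i + c * d) + j) = z ^+ (4 * i + j).
  rewrite (_ : 4 * (i + c * d) + j = 4 * i + j + d * (4 * c))%N; last by lia.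
  by rewrite exprD [z ^+ (d * _)]exprM (prim_expr_order z_prim) expr1n mulr1.
have gper i : g (i + d)%N = g i by rewrite /g /pole -[d]mul1n !zper.
have termE l j : (j < d)%N -> (l * d + j <= m)%N ->
  (1 - z ^+ (8 * (l * d + j) + 1)) * v (l * d + j)%N ^+ 2 * z ^+ (2 * (l * d + j))
     * \prod_(i < l * d + j) g i =
  v (l * d)%N ^+ 2 * z ^+ (2 * (l * d)) * (\prod_(i < l * d) g i) * wp_term z a j.
  move=> jd lm; rewrite prodr_blocks // /wp_term.
  have -> : z ^+ (8 * (l * d + j) + 1) = z ^+ (8 * j + 1).
    rewrite (_ : 8 * (l * d + j) + 1 = 8 * j + 1 + d * (8 * l))%N; last by lia.
    by rewrite exprD [z ^+ (d * _)]exprM (prim_expr_order z_prim) expr1n mulr1.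
  have nz : \prod_(i < j) (1 - z ^+ (4 * i + 4)) != 0.
    apply/prodf_neq0 => i _; rewrite subr_eq0 eq_sym -(prim_order_dvd z_prim).
    by rewrite -mulnSr Gauss_dvdr ?(order_coprime4 r_dvd) // gtnNdvd // (leq_ltn_trans _ jd).
  have -> : v (l * d + j)%N = v (l * d)%N * (\prod_(i < j) (1 - z ^+ (4 * i + 1))
     / \prod_(i < j) (1 - z ^+ (4 * i + 4))) by rewrite mulrA -vE // mulfK.
  rewrite wp_prodE -/g; move: (\prod_(i < j) g i) => G.
  by rewrite mulnDr [z ^+ (2 * (l * d) + _)]exprD; ring.
have blockE l s : (s <= d)%N -> (l * d + s <= m.+1)%N ->
  \sum_(i < s) ((1 - z ^+ (8 * (l * d + i) + 1)) * v (l * d + i)%N ^+ 2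
    * z ^+ (2 * (l * d + i)) * \prod_(i0 < l * d + i) g i0) =
  v (l * d)%N ^+ 2 * z ^+ (2 * (l * d)) * (\prod_(i < l * d) g i)
   * \sum_(i < s) wp_term z a i.
  move=> sd lm; rewrite mulr_sumr; apply: eq_bigr => i _; have is_ := ltn_ord i.
  by apply: termE; [exact: leq_trans sd | rewrite -ltnS -addnS (leq_trans _ lm) // leq_add2l].
(* The last block, of length r + 1, vanishes by reflection; a full block only adds the zero terms r
   < k < d. *)
have sum_r : \sum_(i < r.+1) wp_term z a i = 0 by apply: wp_sum_reflect.
have sum_d : \sum_(i < d) wp_term z a i = 0.
  rewrite -(subnKC r_lt) big_split_ord /= sum_r add0r big1 // => i _.
  by apply: (wp_term_gt r_dvd); exact: leq_addr.
rewrite [m in m.+1]mE -addnS -/g.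
rewrite (sumr_blocks (fun k => (1 - z ^+ (8 * k + 1)) * v k ^+ 2 * z ^+ (2 * k) * \prod_(i < k) g i)).
rewrite blockE ?sum_r ?mulr0 ?addr0 //; last by rewrite addnS -mE.
rewrite big1 // => l _; rewrite blockE ?sum_d ?mulr0 // mE.
have := ltn_ord l; rewrite -(leq_pmul2r d_gt0) mulSn => ?; lia.
Qed.

End RootOfUnity.

(** * Coefficients without poles at roots of unity *)

(** The witness is the Gaussian binomial [s+k choose k], built by the q-Pascal rule without
    division. The sigma type lets it be chosen as a function of k. *)
Lemma gauss_binomial (R : comNzRingType) (p : R) s k :
  {c | c * \prod_(i < k) (1 - p ^+ i.+1) = \prod_(i < k) (1 - p ^+ (s + i.+1))}.
Proof.
elim: k s => [|k IHk] s; first by exists 1; rewrite !big_ord0 mulr1.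
elim: s => [|s [c IHs]]; first by exists 1; rewrite mul1r; apply: eq_bigr.
have [b Hb] := IHk s.+1; exists (c + p ^+ s.+1 * b).
rewrite mulrDl {}IHs big_ord_recl -mulrA.
rewrite (eq_bigr (fun i : 'I_k => 1 - p ^+ (s.+1 + i.+1))) => [|i _]; last first.
  by rewrite lift0 addSnnS.
rewrite [in RHS]big_ord_recr [in X in _ + X]big_ord_recr /= -Hb addn1 [p ^+ (_ + k.+1)]exprD.
by ring.
Qed.

Lemma subr1_Xn_neq0 (R : nzRingType) n : (0 < n)%N -> 1 - 'X^n != 0 :> {poly R}.
Proof. by move=> n0; rewrite -oppr_eq0 opprB monic_neq0 ?monicXnsubC. Qed.

Definition qnum (R : nzRingType) (q : R) n := \sum_(i < n) q ^+ i.

Lemma qnumE (R : comNzRingType) (q : R) n : (1 - q) * qnum q n = 1 - q ^+ n.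
Proof. by rewrite -[in RHS](expr1n _ n) subrXX; congr (_ * _); apply: eq_bigr => i _; rewrite expr1n mul1r. Qed.

Local Notation ratC := (map_poly (ratr : rat -> algC)).

(** Coprimality can be tested over the algebraic numbers, where a nontrivial common factor has a
    root. *)
Lemma coprimep_subr1_Xn (p : {poly rat}) n :
  (forall z : algC, z ^+ n = 1 -> (ratC p).[z] != 0) -> coprimep p (1 - 'X^n).
Proof.
move=> p_nz; rewrite coprimep_sym -(coprimep_map (ratr : {rmorphism rat -> algC})).
apply: Pdiv.ClosedField.root_coprimep => z /rootP z_root; apply: p_nz.
apply/eqP; rewrite eq_sym -subr_eq0 -[X in _ == X]z_root.
by rewrite rmorphB rmorph1 /= map_polyXn hornerD hornerN hornerXn hornerC.
Qed.

(* With g = gcd(A, n), both 1 - q^A and 1 - q^(A + mn) are 1 - q^g times a factor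
   that does not vanish at the n-th roots of unity. *)
Lemma coprime_shifted_ratio A m n : (0 < n)%N -> (0 < A)%N ->
  {xy : {poly rat} * {poly rat} | (1 - 'X^A) * xy.2 = (1 - 'X^(A + m * n)) * xy.1
    & coprimep xy.2 (1 - 'X^n)}.
Proof.
move=> n0 A0; pose g := gcdn A n.
have g0 : (0 < g)%N by rewrite gcdn_gt0 A0.
have dvB : (g %| A + m * n)%N by rewrite dvdn_add ?dvdn_gcdl // dvdn_mull ?dvdn_gcdr.
exists (qnum 'X^g (A %/ g), qnum 'X^g ((A + m * n) %/ g)) => /=.
  rewrite -{1}(divnK (dvdn_gcdl A n)) -{2}(divnK dvB) -/g !(mulnC _ g) !exprM -!qnumE.
  by ring.
apply: coprimep_subr1_Xn => z zn.
(* If z^g = 1 the value at z is the positive integer (A + mn)/g. Otherwise a zero would give z^A = 1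
   and, with z^n = 1, z^g = 1. *)
have [zA | zA] := eqVneq (z ^+ g) 1.
  rewrite rmorph_sum /= horner_sum (eq_bigr (fun=> 1)) => [|i _]; last first.
    by rewrite !rmorphXn /= map_polyX !horner_exp hornerX zA expr1n.
  rewrite sumr_const card_ord pnatr_eq0 -lt0n divn_gt0 // dvdn_leq //.
  by rewrite addn_gt0 A0.
apply: contraNneq zA => y0.
have := congr1 (fun u => (ratC u).[z]) (qnumE ('X^g : {poly rat}) ((A + m * n) %/ g)).
rewrite rmorphM /= hornerM y0 mulr0 -exprM mulnC divnK // rmorphB rmorph1 /= map_polyXn.
rewrite hornerD hornerN hornerXn hornerC exprD (mulnC m) exprM zn expr1n mulr1 => /eqP.
rewrite eq_sym subr_eq0 eq_sym => zA1.
have [d z_prim dn] := prim_order_exists n0 zn.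
by rewrite -(prim_order_dvd z_prim) dvdn_gcd dn andbT (prim_order_dvd z_prim).
Qed.

(** [v k / w] is (q;q^4)_k / (q^4;q^4)_k with a denominator that has no zero at the n-th roots of
    unity, whereas (q^4;q^4)_k may vanish there. *)
Lemma pochhammer_ratio_integral m : exists (w : {poly rat}) (v : nat -> {poly rat}),
  coprimep w (1 - 'X^(4 * m + 1)) /\
  forall k, (k <= m)%N ->
    v k * \prod_(i < k) (1 - 'X^(4 * i + 4)) = w * \prod_(i < k) (1 - 'X^(4 * i + 1)).
Proof.
set n := (4 * m + 1)%N; have n0 : (0 < n)%N by rewrite /n addn1.
have A_gt0 i : (0 < 4 * i + 1)%N by rewrite addn1.
pose x i := (s2val (coprime_shifted_ratio 3 n0 (A_gt0 i))).1.
pose y i := (s2val (coprime_shifted_ratio 3 n0 (A_gt0 i))).2.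
have xy i : (1 - 'X^(4 * i + 1)) * y i = (1 - 'X^(4 * i + 1 + 3 * n)) * x i.
  exact: (s2valP (coprime_shifted_ratio 3 n0 (A_gt0 i))).
have y_co i : coprimep (y i) (1 - 'X^n) := s2valP' (coprime_shifted_ratio 3 n0 (A_gt0 i)).
pose c k := sval (gauss_binomial ('X^4 : {poly rat}) (3 * m) k).
have cE k : c k * \prod_(i < k) (1 - 'X^(4 * i + 4)) = \prod_(i < k) (1 - 'X^(4 * i + 1 + 3 * n)).
  rewrite (eq_bigr (fun i : 'I_k => 1 - 'X^4 ^+ i.+1)) => [|i _]; last by rewrite -exprM mulnSr.
  rewrite (svalP (gauss_binomial _ _ _)); apply: eq_bigr => i _; rewrite -exprM.
  by congr (1 - 'X^_); rewrite /n; lia.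
(* One [w] serves all k <= m: it collects every [y i], and [v k] keeps those with i >= k. *)
exists (\prod_(i < m) y i), (fun k => c k * \prod_(i < k) x i * \prod_(k <= i < m) y i).
split=> [|k km].
  rewrite coprimep_sym; elim/big_rec: _ => [|i p _]; first exact: coprimep1.
  by rewrite coprimepMr [coprimep _ (y i)]coprimep_sym y_co.
have -> : \prod_(i < m) y i = \prod_(i < k) y i * \prod_(k <= i < m) y i.
  by rewrite -!(big_mkord xpredT y) -big_cat_nat.
have : \prod_(i < k) (1 - 'X^(4 * i + 1)) * \prod_(i < k) y i =
    \prod_(i < k) (1 - 'X^(4 * i + 1 + 3 * n)) * \prod_(i < k) x i.
  by rewrite -!big_split; apply: eq_bigr => i _; apply: xy.
have := cE k; move: (c k) (\prod_(k <= i < m) y i).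
move: (\prod_(i < k) _) (\prod_(i < k) _) (\prod_(i < k) _) (\prod_(i < k) _) (\prod_(i < k) _).
move=> x' P y' A B c' t cPA Bxy.
transitivity (c' * B * x' * t); first by ring.
by rewrite cPA -Bxy; ring.
Qed.

Lemma even_pochhammer_ratio_integral m n : odd n ->
  exists b w : {poly rat}, coprimep w (1 - 'X^n) /\
    b * \prod_(i < m) (1 - 'X^(4 * i + 4)) = w * \prod_(i < m) (1 - 'X^(4 * i + 2)).
Proof.
move=> n_odd; have [c cE] := gauss_binomial ('X^2 : {poly rat}) m m.
pose P := \prod_(i < m) (1 - ('X^2 : {poly rat}) ^+ i.+1).
pose Q := \prod_(i < m) (1 + ('X^2 : {poly rat}) ^+ i.+1).
exists c, (Q ^+ 2); split.
  rewrite coprimep_sym coprimep_expr //; elim/big_rec: (Q) => [|i p _ IH]; first exact: coprimep1.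
  rewrite coprimepMr IH andbT coprimep_sym; apply: coprimep_subr1_Xn => z zn.
  rewrite rmorphD rmorph1 /= -exprM map_polyXn hornerD hornerC hornerXn.
  (* If z^(2i+2) = -1, raising to the odd power n gives 1 = -1. *)
  apply: contra_eq_neq zn => /eqP; rewrite addrC addr_eq0 => /eqP zi.
  apply: contraTneq (oner_neq0 algC) => zn.
  have := congr1 (fun u => u ^+ n) zi; rewrite -exprM mulnC exprM zn expr1n.
  rewrite -signr_odd n_odd expr1 => /eqP; rewrite -addr_eq0 -mulr2n pnatr_eq0 //.
have PQ : P * Q = \prod_(i < m) (1 - 'X^(4 * i + 4)).
  rewrite -big_split; apply: eq_bigr => i _ /=.
  rewrite -subr_sqr expr1n -!exprM; congr (1 - 'X^_); lia.
have nz : \prod_(i < m) (1 - 'X^(4 * i + 4)) != 0 :> {poly rat}.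
  by apply/prodf_neq0 => i _; rewrite subr1_Xn_neq0 // addn4.
apply: (mulIf nz); rewrite -!mulrA; rewrite -[in LHS]PQ.
(* (q^2;q^4)_m and (q^4;q^4)_m interleave to (q^2;q^2)_{2m}. *)
have -> : \prod_(i < m) (1 - 'X^(4 * i + 2)) * \prod_(i < m) (1 - 'X^(4 * i + 4)) =
   \prod_(i < m + m) (1 - ('X^2 : {poly rat}) ^+ i.+1).
  elim: (m) => [|j IH]; first by rewrite !big_ord0 mulr1.
  rewrite addSn addnS !big_ord_recr /= -IH -!exprM.
  have -> : (2 * (j + j).+1 = 4 * j + 2)%N by lia.
  have -> : (2 * (j + j).+2 = 4 * j + 4)%N by lia.
  by ring.
have -> : \prod_(i < m + m) (1 - ('X^2 : {poly rat}) ^+ i.+1) = P * (c * P).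
  by rewrite cE big_split_ord; congr (_ * _); apply: eq_bigr => i _; rewrite /= addnS.
by ring.
Qed.

(** * Divisibility in Q[q][a] from evaluations *)

Definition evalq (z : algC) : {rmorphism {poly rat} -> algC} := horner_eval z \o ratC.
(* Sends q to z and a to x. *)
Definition evalqa (z x : algC) : {rmorphism {poly {poly rat}} -> algC} :=
  horner_eval x \o map_poly (evalq z).

Lemma poly_eq0_nat (p : {poly algC}) : (forall k, p.[k.+2%:R] = 0) -> p = 0.
Proof.
move=> p0; apply/eqP/negPn/negP => pn0.
have := @max_poly_roots _ p [seq k.+2%:R | k <- iota 0 (size p)] pn0.
rewrite size_map size_iota ltnn => H; apply: notF; apply: H.
  by apply/allP => _ /mapP[k _ ->]; apply/rootP.
rewrite map_inj_uniq ?iota_uniq // => i j /eqP; rewrite eqr_nat => /eqP [].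
by [].
Qed.

(* The factor 1 - z disposes of z = 1, which is not a root of [n]; the integers
   k + 2 supply infinitely many values of a that are not roots of unity. *)
Lemma qnum_dvd_of_eval n (p : {poly {poly rat}}) : (0 < n)%N ->
  (forall z : algC, z ^+ n = 1 -> forall k, (1 - z) * evalqa z k.+2%:R p = 0) ->
  exists p1, p = (qnum 'X n)%:P * p1.
Proof.
move=> n0 p0; pose N : {poly rat} := qnum 'X n.
have dv j : N %| p`_j.
  (* Multiplied by 1 - X the divisor becomes 1 - X^n, which splits into distinct linear factors over
     [algC]. *)
  rewrite -(@dvdp_mul2l _ (1 - 'X)); last by rewrite -['X]expr1 subr1_Xn_neq0.
  rewrite qnumE -(dvdp_map (ratr : {rmorphism rat -> algC})).
  have [z z_prim] := C_prim_root_exists n0.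
  rewrite rmorphB rmorph1 /= map_polyXn -opprB dvdpNl -(factor_Xn_sub_1 z_prim).
  rewrite -(big_map (fun i => z ^+ i) xpredT (fun x => 'X - x%:P)).
  apply: uniq_roots_dvdp.
    apply/allP => _ /mapP[i _ ->]; apply/rootP.
    rewrite rmorphM rmorphB rmorph1 /= map_polyX hornerM hornerD hornerN hornerX hornerC.
    have zi : (z ^+ i) ^+ n = 1 by rewrite exprAC (prim_expr_order z_prim) expr1n.
    have /polyP/(_ j) : (1 - z ^+ i) *: map_poly (evalq (z ^+ i)) p = 0.
      by apply: poly_eq0_nat => k; rewrite hornerZ; apply: p0.
    by rewrite coefZ coef_map coef0.
  rewrite uniq_rootsE map_inj_in_uniq ?iota_uniq // => i1 i2; rewrite !mem_index_iota /= => i1n i2n /eqP.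
  by rewrite (eq_prim_root_expr z_prim) !modn_small // => /eqP.
exists (\poly_(j < size p) (p`_j %/ N)); apply/polyP => j.
rewrite coefCM coef_poly; case: ltnP => [_ | /(nth_default 0) ->]; last by rewrite mulr0.
by rewrite mulrC divpK.
Qed.

(* The leading coefficient of 1 - cX is not a unit: a power of c is the price of
   the division. *)
Lemma reciprocal_roots_factor (R : idomainType) (F : fieldType) (t : {rmorphism R -> F}) (p : {poly R}) (c : R) :
  injective t -> c != 0 -> c ^+ 2 != 1 -> p.[c] = 0 -> (map_poly t p).[(t c)^-1] = 0 ->
  exists s p1, (c ^+ s)%:P * p = (1 - 'X * c%:P) * ('X - c%:P) * p1.
Proof.
move=> t_inj c0 c2 /rootP/factor_theorem[p1 ->].
have tc0 : t c != 0 by rewrite -(rmorph0 t) (inj_eq t_inj).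
rewrite rmorphM hornerM rmorphB /= map_polyX map_polyC hornerD hornerN hornerX hornerC.
(* The root 1/c belongs to the cofactor [p1], because 1/c = c is excluded by c^2 != 1. *)
move/eqP; rewrite mulf_eq0 orbC => /orP[|/eqP p1c].
  rewrite subr_eq0 -(inj_eq (mulIf tc0)) mulVf // -expr2 -rmorphXn eq_sym.
  by rewrite -(rmorph1 t) (inj_eq t_inj) (negPf c2).
pose l : {poly R} := (- c)%:P * 'X + 1%:P.
have lE : 1 - 'X * c%:P = l by rewrite /l polyCN; ring.
have ls : size l = 2%N.
  by rewrite size_MXaddC polyC_eq0 oppr_eq0 (negPf c0) size_polyC oppr_eq0 c0.
have lc : lead_coef l = - c by rewrite lead_coefE ls coefD coefMX !coefC /= addr0.
have := Pdiv.Idomain.divp_eq p1 l; rewrite lc; set s := Pdiv.Idomain.scalp _ _ => eq1.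
have mod_size : (size (p1 %% l)%R < 2)%N by rewrite -ls Pdiv.Idomain.ltn_modpN0 // -size_poly_eq0 ls.
have lt0 : (map_poly t l).[(t c)^-1] = 0.
  rewrite /l rmorphD rmorphM /= !map_polyC map_polyX !(hornerD, hornerM, hornerC, hornerX) /=.
  by rewrite [t (- c)]rmorphN mulNr divff // rmorph1 addNr.
(* The remainder is a constant in X that must vanish at 1/c. *)
have mod0 : p1 %% l = 0.
  move: eq1; rewrite (size1_polyC mod_size) => /(congr1 (fun u => (map_poly t u).[(t c)^-1])).
  rewrite /= map_polyZ rmorphD rmorphM /= map_polyC hornerZ p1c mulr0 hornerD hornerM hornerC.
  rewrite lt0 mulr0 add0r => /eqP.
  by rewrite eq_sym -(rmorph0 t) (inj_eq t_inj) => /eqP ->.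
(* Pseudo-division scales by (-c)^s; the sign is moved into the quotient. *)
exists s, ((-1) ^+ s *: (p1 %/ l)).
rewrite mod0 addr0 in eq1.
have -> : (c ^+ s)%:P * (p1 * ('X - c%:P)) = (c ^+ s *: p1) * ('X - c%:P).
  by rewrite mulrA mul_polyC.
have -> : c ^+ s *: p1 = (-1) ^+ s *: (p1 %/ l * l).
  by rewrite -eq1 scalerA -exprMn mulN1r opprK.
by rewrite lE -!mul_polyC; ring.
Qed.

Lemma rmorph_pole (R S : nzRingType) (f : {rmorphism R -> S}) q a j :
  f (pole q a j) = pole (f q) (f a) j.
Proof. by rewrite /pole rmorphM !rmorphB rmorphM rmorph1 !rmorphXn. Qed.

(** Common denominator in [a] of all summands: (aq^4;q^4)_m (q^4/a;q^4)_m up to the factor a^m. *)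
Definition poles m := \prod_(i < m) pole qP aP (4 * i + 4).

Lemma rmorph_poles (S : comNzRingType) (f : {rmorphism {poly {poly rat}} -> S}) m :
  f (poles m) = \prod_(i < m) pole (f qP) (f aP) (4 * i + 4).
Proof. by rewrite rmorph_prod; apply: eq_bigr => i _; apply: rmorph_pole. Qed.

Lemma poleV (F : fieldType) (q a : F) j : a != 0 -> pole q a^-1 j = a ^- 2 * pole q a j.
Proof. by move=> a0; rewrite /pole; field. Qed.

Lemma pole_poly (F : fieldType) (c u : F) n : u != 0 ->
  c%:P * pole u%:P 'X n = (c * - u ^+ n) *: (('X - (u ^- n)%:P) * ('X - (u ^+ n)%:P)).
Proof.
move=> u0; rewrite /pole -mul_polyC polyCM polyC_exp -!mulrA; congr (_ * _).
rewrite mulrA; congr (_ * _).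
by rewrite mulrBr -polyCM mulNr mulfV ?expf_neq0 // !polyCN opprK polyC_exp; ring.
Qed.

(** * Specializing a with q generic; coprimality to the modulus *)

Section Specialization.
Variables (F : fieldType) (t : {rmorphism {poly rat} -> F}).
Hypothesis t_inj : injective t.
Local Notation x := (t 'X).

Definition evalF (y : F) : {rmorphism {poly {poly rat}} -> F} := horner_eval y \o map_poly t.

Lemma evalF_polyC y c : evalF y c%:P = t c.
Proof. by rewrite /evalF /= map_polyC /horner_eval hornerC. Qed.

Lemma evalF_aP y : evalF y aP = y.
Proof. by rewrite /evalF /= map_polyX /horner_eval hornerX. Qed.

Lemma inj_eq0 c : (t c == 0) = (c == 0).
Proof. by rewrite -(rmorph0 t) (inj_eq t_inj). Qed.

Lemma injX_free i : (0 < i)%N -> x ^+ i != 1.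
Proof.
move=> i0; rewrite -rmorphXn -(rmorph1 t) (inj_eq t_inj) -subr_eq0 -opprB oppr_eq0.
exact: subr1_Xn_neq0.
Qed.

Lemma injX_neq0 : x != 0. Proof. by rewrite inj_eq0 polyX_eq0. Qed.

Lemma pole_neq0 n j : n != j -> (0 < n + j)%N -> pole x (x ^+ n) j != 0.
Proof.
move=> nj nj0; rewrite /pole mulf_neq0 ?(subr_expr_neq0 injX_neq0 injX_free) //.
by rewrite -exprD (subr1_expr_neq0 injX_neq0 injX_free).
Qed.

Lemma pole_odd_neq0 n i : odd n -> pole x (x ^+ n) (4 * i + 4) != 0.
Proof.
move=> n_odd; apply: pole_neq0; last by lia.
by apply: contraTneq n_odd => ->; rewrite oddD oddM.
Qed.

Lemma poleV_odd_neq0 n i : odd n -> pole x (x ^- n) (4 * i + 4) != 0.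
Proof.
move=> n_odd; rewrite poleV ?expf_neq0 ?injX_neq0 //; apply: mulf_neq0 (pole_odd_neq0 _ _) => //.
by rewrite invr_eq0 !expf_neq0 // injX_neq0.
Qed.

Lemma poles_neq0 m n : odd n -> evalF (x ^+ n) (poles m) != 0.
Proof.
move=> n_odd; rewrite rmorph_poles evalF_polyC evalF_aP; apply/prodf_neq0 => i _.
exact: pole_odd_neq0.
Qed.

Lemma polesV_neq0 m n : odd n -> evalF (x ^- n) (poles m) != 0.
Proof.
move=> n_odd; rewrite rmorph_poles evalF_polyC evalF_aP; apply/prodf_neq0 => i _.
exact: poleV_odd_neq0.
Qed.

(** Over [F] the two polynomials in [a] have no common root, so a common divisor is free of [a]. It
    then divides both [n] and [d] times a power of q up to sign, which are coprime. *)
Lemma coprimeR_poles m n (d : {poly rat}) : odd n -> d != 0 -> coprimep d (qnum 'X n) ->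
  coprimeR (d%:P * poles m) ((qnum 'X n)%:P * pole qP aP n).
Proof.
move=> n_odd d0 dN c [M1 D_eq] [M2 P_eq].
set N := qnum 'X n in dN P_eq *.
have n0 : (0 < n)%N by case: (n) n_odd.
have N0 : N != 0.
  by apply: contraTneq (subr1_Xn_neq0 rat n0) => N0; rewrite -qnumE -/N N0 mulr0 eqxx.
have xn0 : x ^+ n != 0 by rewrite expf_neq0 ?injX_neq0.
have cop : coprimep (map_poly t (d%:P * poles m)) (map_poly t (N%:P * pole qP aP n)).
  have -> : map_poly t (N%:P * pole qP aP n) =
     (t N * - x ^+ n) *: (('X - (x ^- n)%:P) * ('X - (x ^+ n)%:P)).
    by rewrite rmorphM rmorph_pole /= !map_polyC map_polyX pole_poly ?injX_neq0.
  rewrite coprimepZr; last by rewrite mulf_neq0 ?oppr_eq0 ?inj_eq0.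
  rewrite coprimepMr !coprimep_XsubC /root.
  have H y : (map_poly t (d%:P * poles m)).[y] = t d * evalF y (poles m).
    by rewrite rmorphM hornerM /= map_polyC hornerC.
  by rewrite !H !mulf_neq0 ?inj_eq0 ?poles_neq0 ?polesV_neq0.
have c_size : size c = 1%N.
  rewrite -(size_map_inj_poly t_inj (rmorph0 t)); apply/eqP; rewrite size_poly_eq1.
  move/coprimepP: cop; apply.
    by rewrite D_eq rmorphM dvdp_mulr.
  by rewrite P_eq rmorphM dvdp_mulr.
have [c0 cE] : exists c0, c = c0%:P by exists c`_0; apply: size1_polyC; rewrite c_size.
rewrite {}cE in D_eq P_eq c_size *.
have PE y : N * (pole qP aP n).[y] = c0 * M2.[y] by rewrite -!hornerCM P_eq.
have D0 : d * (poles m).[0] = c0 * M1.[0] by rewrite -!hornerCM D_eq.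
have evp j y : (pole qP aP j).[y] = pole 'X y j.
  by rewrite -/(horner_eval y _) rmorph_pole /= /horner_eval /qP /aP hornerC hornerX.
(* Values at a = 1 and a = 0: (1 - q^n)^2 and -q^n are comaximal. *)
have c0N : c0 %| N.
  have -> : N = N * pole 'X 1 n + N * pole 'X 0 n * ('X^n - 2%:R) by rewrite /pole; ring.
  apply: dvdp_add; first by rewrite -evp PE dvdp_mulIl.
  by rewrite -evp PE -mulrA dvdp_mulIl.
have N_0 : N.[0] = 1.
  rewrite /N /qnum horner_sum -(prednK n0) big_ord_recl hornerXn expr0 big1 ?addr0 // => i _.
  by rewrite hornerXn expr0n.
(* At a = 0 each factor of [poles] is minus a power of q, and [n] has constant term 1. *)
have copN : coprimep (d * (poles m).[0]) N.
  rewrite coprimepMl dN /= -/(horner_eval 0 _) rmorph_poles; elim/big_rec: _ => [|i p _ IH].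
    exact: coprime1p.
  rewrite coprimepMl IH andbT /pole /= /horner_eval /qP /aP hornerC hornerX mul0r subr0 mul1r sub0r.
  rewrite -scaleN1r coprimepZl ?oppr_eq0 ?oner_eq0 // coprimep_expl // coprimep_sym -['X]subr0 -(polyC0) coprimep_XsubC.
  by rewrite /root N_0 oner_eq0.
have : c0 %= 1.
  by move/coprimepP: copN; apply => //; rewrite D0 dvdp_mulIl.
rewrite -size_poly_eq1 => /size_poly1P[k k0 ->].
by rewrite !poly_unitE !coefC /= !size_polyC polyC_eq0 k0 unitfE.
Qed.

End Specialization.

(** * The cleared left-hand side and its divisibility by [n] *)

Lemma rmorph_qnum (R S : nzRingType) (f : {rmorphism R -> S}) q n : f (qnum q n) = qnum (f q) n.
Proof. by rewrite rmorph_sum; apply: eq_bigr => i _; rewrite rmorphXn. Qed.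

Section Numerator.
Variables (m : nat) (w : {poly rat}) (v : nat -> {poly rat}).
Hypothesis vE : forall k, (k <= m)%N ->
  v k * \prod_(i < k) (1 - 'X^(4 * i + 4)) = w * \prod_(i < k) (1 - 'X^(4 * i + 1)).

(** The left-hand side of the theorem times w^2 [poles m], with the cancellations carried out so
    that it lies in Q[q][a]. *)
Definition numer : {poly {poly rat}} := \sum_(k < m.+1)
  (qnum 'X (8 * k + 1) * v k ^+ 2 * 'X^(2 * k))%:P
  * (\prod_(i < k) pole qP aP (4 * i + 1) * \prod_(k <= i < m) pole qP aP (4 * i + 4)).

Section Eval.
Variables (K : fieldType) (f : {rmorphism {poly {poly rat}} -> K}).
Let q := f qP.
Let a := f aP.
Hypothesis poles_f : forall i, pole q a (4 * i + 4) != 0.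

Lemma rmorph_qXn i : f ('X^i)%:P = q ^+ i.
Proof. by rewrite polyC_exp rmorphXn. Qed.

Lemma rmorph_qnum_qP i : f (qnum 'X i)%:P = qnum q i.
Proof. by rewrite (rmorph_qnum polyC) rmorph_qnum. Qed.

(** Only values of [pole] are inverted, so this form applies at roots of unity; [numer_wp_sum] is
    the counterpart for generic q. *)
Lemma numer_eval : (1 - q) * f numer = f (poles m) *
  \sum_(k < m.+1) (1 - q ^+ (8 * k + 1)) * f (v k)%:P ^+ 2 * q ^+ (2 * k)
     * \prod_(i < k) (pole q a (4 * i + 1) / pole q a (4 * i + 4)).
Proof.
rewrite rmorph_sum /= !mulr_sumr; apply: eq_bigr => k _; have km : (k <= m)%N by rewrite -ltnS.
rewrite rmorphM !polyCM !rmorphM /= rmorph_qXn rmorph_qnum_qP !rmorph_prod /=.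
rewrite -(qnumE q (8 * k + 1)).
have -> : \prod_(i < m) f (pole qP aP (4 * i + 4)) =
  \prod_(i < k) f (pole qP aP (4 * i + 4)) * \prod_(k <= i < m) f (pole qP aP (4 * i + 4)).
  by rewrite -!(big_mkord xpredT (fun i => f (pole qP aP (4 * i + 4)))) -big_cat_nat.
have -> : \prod_(i < k) f (pole qP aP (4 * i + 1)) = \prod_(i < k) f (pole qP aP (4 * i + 4)) *
   \prod_(i < k) (pole q a (4 * i + 1) / pole q a (4 * i + 4)).
  rewrite -big_split; apply: eq_bigr => i _ /=.
  by rewrite !rmorph_pole mulrCA mulfV ?mulr1.
by ring.
Qed.

Lemma rmorph_prod_qP (e : nat -> nat) j :
  f (\prod_(i < j) (1 - 'X^(e i)))%:P = \prod_(i < j) (1 - q ^+ e i).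
Proof.
by rewrite !rmorph_prod; apply: eq_bigr => i _; rewrite /= polyCB polyC1 rmorphB rmorph1 rmorph_qXn.
Qed.

Lemma rmorph_vE k : (k <= m)%N ->
  f (v k)%:P * \prod_(i < k) (1 - q ^+ (4 * i + 4)) = f w%:P * \prod_(i < k) (1 - q ^+ (4 * i + 1)).
Proof.
move=> km; by rewrite -!(rmorph_prod_qP (fun i => (4 * i + _)%N)) -!rmorphM /= vE.
Qed.

Lemma numer_wp_sum : (forall i, (0 < i)%N -> q ^+ i != 1) ->
  (1 - q) * f numer = f (w ^+ 2)%:P * f (poles m) * wp_sum q a m.
Proof.
move=> q_free; rewrite numer_eval [f (w ^+ 2)%:P * _]mulrC -mulrA; congr (_ * _).
rewrite mulr_sumr; apply: eq_bigr => k _; have km : (k <= m)%N by rewrite -ltnS.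
rewrite /wp_term wp_prodE.
have nz : \prod_(i < k) (1 - q ^+ (4 * i + 4)) != 0.
  by apply/prodf_neq0 => i _; rewrite subr_eq0 eq_sym q_free // addn4.
have -> : f (v k)%:P = f w%:P * (\prod_(i < k) (1 - q ^+ (4 * i + 1)) / \prod_(i < k) (1 - q ^+ (4 * i + 4))).
  by rewrite mulrA -rmorph_vE // mulfK.
by rewrite polyC_exp rmorphXn /=; ring.
Qed.

End Eval.

(** The first k factors are cancelled in Q[q], since they may vanish after evaluation. This supplies
    the block hypothesis of [weighted_sum_eq0]. *)
Lemma v_blocks k j : (k + j <= m)%N ->
  v (k + j)%N * \prod_(i < j) (1 - 'X^(4 * (k + i) + 4)) = v k * \prod_(i < j) (1 - 'X^(4 * (k + i) + 1)).
Proof.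
move=> km; have nz : \prod_(i < k) (1 - 'X^(4 * i + 4)) != 0 :> {poly rat}.
  by apply/prodf_neq0 => i _; rewrite subr1_Xn_neq0 // addn4.
have := vE km; have := vE (leq_trans (leq_addr j k) km); rewrite !big_split_ord /=.
move=> ek ekj; apply: (mulfI nz); rewrite mulrCA ekj mulrCA -mulrCA mulrA -ek.
by ring.
Qed.

Lemma qnum_dvd_numer : exists p, numer = (qnum 'X (4 * m + 1))%:P * p.
Proof.
apply: qnum_dvd_of_eval => [|z zn k]; first by rewrite addn1.
have [d z_prim dn] := @prim_order_exists _ (4 * m + 1) z (ltac:(by rewrite addn1)) zn.
have zq : evalqa z k.+2%:R qP = z.
  by rewrite /evalqa /= map_polyC /horner_eval hornerC /= /evalq /= map_polyX /horner_eval hornerX.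
have za : evalqa z k.+2%:R aP = k.+2%:R.
  by rewrite /evalqa /= map_polyX /horner_eval hornerX.
(* This keeps the value k + 2 of [a] away from all powers of z. *)
have k_neq1 : k.+2%:R ^+ (4 * m + 1) != 1 :> algC.
  by rewrite -natrX pnatr_eq1 addn1 expnS muln_eq1.
have k_gen i : k.+2%:R * z ^+ i != 1.
  apply: contraNneq k_neq1 => kz; have := congr1 (fun u => u ^+ (4 * m + 1)) kz.
  by rewrite exprMn exprAC zn !expr1n mulr1 => ->.
have k_gen' i : k.+2%:R != z ^+ i.
  by apply: contraNneq k_neq1 => ->; rewrite exprAC zn expr1n.
have prodE c l j : evalqa z k.+2%:R (\prod_(i < j) (1 - 'X^(4 * (l * d + i) + c)))%:P =
    \prod_(i < j) (1 - z ^+ (4 * i + c)).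
  rewrite (rmorph_prod_qP _ (fun i => 4 * (l * d + i) + c)%N) zq; apply: eq_bigr => i _.
  rewrite (_ : 4 * (l * d + i) + c = 4 * i + c + d * (4 * l))%N; last by lia.
  by rewrite exprD [z ^+ (d * _)]exprM (prim_expr_order z_prim) expr1n mulr1.
have poles_z i : pole z k.+2%:R (4 * i + 4) != 0 by rewrite mulf_neq0 ?subr_eq0 // eq_sym.
rewrite -{1}zq numer_eval zq za; last exact: poles_z.
rewrite [X in _ * X](_ : _ = 0) ?mulr0 //.
have C2 : 2%:R != 0 :> algC by rewrite pnatr_eq0.
apply: (@weighted_sum_eq0 _ z _ d z_prim k_gen k_gen' C2 m (fun j => evalqa z k.+2%:R (v j)%:P) dn).
by move=> l j jd ljm; rewrite -!(prodE _ l) -!rmorphM /= v_blocks.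
Qed.

End Numerator.

(** * Both sides as fractions, and assembly *)

(** Each factor 1 - u/a is (a - u)/a, and the powers of 1/a cancel between numerator and
    denominator. *)
Lemma wp_sum_qpoch (K : fieldType) (q a : K) m (poch := fun x y k => \prod_(i < k) (1 - x * y ^+ i)) :
  a != 0 ->
  \sum_(0 <= k < m.+1)
    (1 - q ^+ (8 * k + 1)) / (1 - q) *
    (poch q (q ^+ 4) k ^+ 2 * poch (a * q) (q ^+ 4) k * poch (q / a) (q ^+ 4) k)
    / (poch (q ^+ 4) (q ^+ 4) k ^+ 2 * poch (a * q ^+ 4) (q ^+ 4) k * poch (q ^+ 4 / a) (q ^+ 4) k)
    * q ^+ (2 * k) = wp_sum q a m / (1 - q).
Proof.
move=> a0; rewrite /wp_sum big_mkord mulr_suml; apply: eq_bigr => k _.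
have pochE u j : poch u (q ^+ 4) j = \prod_(i < j) (1 - u * q ^+ (4 * i)).
  by apply: eq_bigr => i _; rewrite exprM.
rewrite !pochE /wp_term.
have -> : \prod_(i < k) wp_ratio q a i = q ^+ (2 * k) *
  ((\prod_(i < k) (1 - q * q ^+ (4 * i))) ^+ 2 * \prod_(i < k) (1 - a * q * q ^+ (4 * i))
     * \prod_(i < k) (1 - q / a * q ^+ (4 * i)))
  / ((\prod_(i < k) (1 - q ^+ 4 * q ^+ (4 * i))) ^+ 2 * \prod_(i < k) (1 - a * q ^+ 4 * q ^+ (4 * i))
     * \prod_(i < k) (1 - q ^+ 4 / a * q ^+ (4 * i))).
  rewrite exprM -[in q ^+ 2 ^+ k](card_ord k) -prodr_const -!prodrXl -!big_split -prodfV -big_split.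
  apply: eq_bigr => i _; rewrite /= /wp_ratio.
  have shift j : q ^+ (4 * i + j) = q ^+ j * q ^+ (4 * i) by rewrite addnC exprD.
  rewrite !shift expr1; move: (q ^+ (4 * i)) => y.
  have inva u : 1 - u / a * y = (a - u * y) / a by field.
  have cancel (N D u u' : K) : N * (u / a) / (D * (u' / a)) = N * u / (D * u').
    by rewrite -[LHS]mulf_div -[RHS]mulf_div; congr (_ * _); rewrite invf_div mulrA divfK.
  by rewrite !inva [in RHS](mulrA (q ^+ 2)) cancel !mulrA.
move: (_^-1) (_^-1) => u u'; ring.
Qed.

Section Assembly.
Variables (m : nat) (w w' b : {poly rat}) (v : nat -> {poly rat}).
Let n := (4 * m + 1)%N.
Hypothesis vE : forall k, (k <= m)%N ->
  v k * \prod_(i < k) (1 - 'X^(4 * i + 4)) = w * \prod_(i < k) (1 - 'X^(4 * i + 1)).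
Hypothesis bE : b * \prod_(i < m) (1 - 'X^(4 * i + 4)) = w' * \prod_(i < m) (1 - 'X^(4 * i + 2)).

(** The difference of the two sides times w^2 w' q^m [poles m], with b / w' for (q^2;q^4)_m /
    (q^4;q^4)_m. *)
Definition numer_diff := numer m v * (w' * 'X^m)%:P - (qnum 'X n * b * w ^+ 2)%:P * poles m.

Lemma numer_diff_eval (K : fieldType) (f : {rmorphism {poly {poly rat}} -> K})
    (q a : K) : f qP = q -> f aP = a -> q != 0 -> (forall i, (0 < i)%N -> q ^+ i != 1) ->
  (forall i, pole q a (4 * i + 4) != 0) ->
  (1 - q) * f numer_diff =
    f (w ^+ 2 * w' * 'X^m)%:P * f (poles m) * (wp_sum q a m - wp_closed q m).
Proof.
move=> fq fa; subst q a; set q := f qP; set a := f aP => q0 q_free pole0.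
rewrite /numer_diff rmorphB !rmorphM mulrBr [(1 - q) * (f _ * _)]mulrA.
rewrite (numer_wp_sum vE) // /wp_closed.
have P4 : \prod_(i < m) (1 - q ^+ (4 * i + 4)) != 0.
  by apply/prodf_neq0 => i _; rewrite subr_eq0 eq_sym q_free // addn4.
have := congr1 (fun p : {poly rat} => f p%:P) bE.
rewrite !polyCM !rmorphM /= !(rmorph_prod_qP f (fun i => 4 * i + _)%N) rmorph_qnum_qP rmorph_qXn -/q -/a => E.
have -> : f b%:P = f w'%:P * \prod_(i < m) (1 - q ^+ (4 * i + 2)) / \prod_(i < m) (1 - q ^+ (4 * i + 4)).
  by rewrite -E mulfK.
rewrite -(qnumE q (4 * m + 1)) -/n.
by field; rewrite P4 andbT expf_neq0.
Qed.

Lemma numer_diff_root (F : fieldType) (t : {rmorphism {poly rat} -> F}) (y : F) :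
  injective t -> (y = t 'X ^+ n \/ y = t 'X ^- n) -> evalF t y numer_diff = 0.
Proof.
move=> t_inj y_eq; have n_odd : odd n by rewrite /n oddD oddM.
have q0 := injX_neq0 t_inj; have q_free := injX_free t_inj.
have q1 : 1 - t 'X != 0 by rewrite subr_eq0 eq_sym -[t 'X]expr1 q_free.
have := numer_diff_eval (evalF_polyC t y 'X) (evalF_aP t y) q0 q_free.
have -> : wp_sum (t 'X) y m = wp_closed (t 'X) m.
  by case: y_eq => ->; rewrite ?wp_sumV ?expf_neq0 // wp_sum_closed.
rewrite subrr mulr0 => E; apply: (mulfI q1); rewrite mulr0; apply: E => // i.
by case: y_eq => ->; [apply: pole_odd_neq0 | apply: poleV_odd_neq0].
Qed.

(** [n] is divided out first; being nonzero and free of [a], it leaves the roots q^n and q^(-n) to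
    the cofactor. The power of q comes from [reciprocal_roots_factor] with c = q^n and is coprime to
    the modulus. *)
Lemma numer_diff_factor (F : fieldType) (t : {rmorphism {poly rat} -> F}) : injective t ->
  exists s p, ('X^s)%:P * numer_diff = (qnum 'X n)%:P * pole qP aP n * p.
Proof.
move=> t_inj; have [p pE] := qnum_dvd_numer vE.
have n0 : (0 < n)%N by rewrite /n addn1.
have N0 : qnum 'X n != 0 :> {poly rat}.
  by apply: contraTneq (subr1_Xn_neq0 rat n0) => N0; rewrite -qnumE N0 mulr0 eqxx.
pose r := p * (w' * 'X^m)%:P - (b * w ^+ 2)%:P * poles m.
have rE : numer_diff = (qnum 'X n)%:P * r.
  by rewrite /numer_diff pE /r !polyCM mulrBr !mulrA.
have r_root y : y = t 'X ^+ n \/ y = t 'X ^- n -> evalF t y r = 0.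
  move=> /(numer_diff_root t_inj)/eqP; rewrite rE rmorphM evalF_polyC mulf_eq0.
  by rewrite (inj_eq0 t_inj) (negPf N0) => /eqP.
have [||||s [r1 r1E]] := @reciprocal_roots_factor _ F t r 'X^n t_inj.
- by rewrite expf_neq0 // polyX_eq0.
- by rewrite -exprM -subr_eq0 -opprB oppr_eq0 subr1_Xn_neq0 // muln_gt0 n0.
- apply: t_inj; rewrite rmorph0 -horner_map rmorphXn /=; exact: r_root (or_introl _ erefl).
- rewrite rmorphXn /=; exact: r_root (or_intror _ erefl).
exists (n * s)%N, r1; rewrite rE mulrCA exprM r1E /pole /qP /aP polyC_exp; ring.
Qed.

Lemma pole_qPaP_neq0 j : pole qP aP j != 0.
Proof.
rewrite /pole mulf_neq0 //; last by rewrite /qP /aP -polyC_exp polyXsubC_eq0.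
apply: contraNneq (oner_neq0 {poly rat}) => /(congr1 (horner^~ 0)).
by rewrite /= hornerD hornerN hornerM hornerX mul0r subr0 -polyC1 !hornerC => ->.
Qed.

(** The factor q^s is put into both numerator and denominator to match [numer_diff_factor]. *)
Lemma numer_diff_frac (K : fieldType) (f : {rmorphism {poly {poly rat}} -> K}) s
    (q := f qP) (a := f aP) : injective f -> w != 0 -> w' != 0 ->
  wp_sum q a m / (1 - q)
   - \prod_(i < m) (1 - q ^+ (4 * i + 2)) / \prod_(i < m) (1 - q ^+ (4 * i + 4))
     * ((1 - q ^+ n) / (1 - q)) * q ^- m =
  f (('X^s)%:P * numer_diff) / f (('X^s * (w ^+ 2 * w' * 'X^m))%:P * poles m).
Proof.
move=> f_inj w0 w'0; have f_eq0 p : (f p == 0) = (p == 0) by rewrite -(rmorph0 f) (inj_eq f_inj).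
have q0 : q != 0 by rewrite f_eq0 polyC_eq0 polyX_eq0.
have q_free i : (0 < i)%N -> q ^+ i != 1.
  move=> i0; rewrite eq_sym -subr_eq0 -(rmorph_qXn f) -(rmorph1 f) -rmorphB f_eq0 -polyC1 -polyCB polyC_eq0.
  exact: subr1_Xn_neq0.
have pole0 i : pole q a (4 * i + 4) != 0 by rewrite -rmorph_pole f_eq0 pole_qPaP_neq0.
have q1 : 1 - q != 0 by rewrite subr_eq0 eq_sym -[q]expr1 q_free.
have Xs0 : f ('X^s)%:P != 0 by rewrite rmorph_qXn expf_neq0.
have W0 : f (w ^+ 2 * w' * 'X^m)%:P != 0.
  by rewrite f_eq0 polyC_eq0 !mulf_neq0 ?expf_neq0 ?polyX_eq0.
have E0 : f (poles m) != 0 by rewrite rmorph_poles; apply/prodf_neq0 => i _; exact: pole0.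
have nd : f numer_diff = f (w ^+ 2 * w' * 'X^m)%:P * f (poles m) * (wp_sum q a m - wp_closed q m) / (1 - q).
  by rewrite -(numer_diff_eval erefl erefl) // [RHS]mulrAC mulfV ?mul1r.
move: W0 nd; move: (w ^+ 2 * w' * 'X^m) => W W0; rewrite /wp_closed -/n => nd.
have qm0 : q ^+ m != 0 by rewrite expf_neq0.
rewrite [in RHS]polyCM !rmorphM [f numer_diff]nd.
move: (\prod_(i < m) _ / _) (wp_sum _ _ _) (q ^+ m) qm0 => u r y y0.
move: (f ('X^s)%:P) (f W%:P) (f (poles m)) Xs0 W0 E0 => c d e c0 d0 e0.
by field; split_neq0.
Qed.

End Assembly.

Lemma prod_qpoch (K : fieldType) (q : K) j m :
  \prod_(i < m) (1 - q ^+ j * q ^+ 4 ^+ i) = \prod_(i < m) (1 - q ^+ (4 * i + j)).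
Proof. by apply: eq_bigr => i _; rewrite -exprM addnC exprD. Qed.

Theorem theorem3 (n : nat) (hn0 : (0 < n)%N) (hn : (n %% 4)%N = 1%N) :
  congr_mod
    (\sum_(0 <= k < ((n - 1) %/ 4).+1)
       qint (8 * k + 1)%N *
       (qpoch qF (qF ^+ 4) k ^+ 2 * qpoch (aF * qF) (qF ^+ 4) k
          * qpoch (qF / aF) (qF ^+ 4) k)
       / (qpoch (qF ^+ 4) (qF ^+ 4) k ^+ 2
          * qpoch (aF * qF ^+ 4) (qF ^+ 4) k
          * qpoch (qF ^+ 4 / aF) (qF ^+ 4) k)
       * qF ^+ (2 * k)%N)
    (qpoch (qF ^+ 2) (qF ^+ 4) ((n - 1) %/ 4)%N
       / qpoch (qF ^+ 4) (qF ^+ 4) ((n - 1) %/ 4)%N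
       * qint n * qF ^- ((n - 1) %/ 4)%N)
    ((\sum_(i < n) qP ^+ i) * (1 - aP * qP ^+ n) * (aP - qP ^+ n)).
Proof.
have [m ->] : exists m, n = (4 * m + 1)%N.
  by exists (n %/ 4)%N; rewrite {1}(divn_eq n 4) hn mulnC.
move=> {n hn0 hn}; rewrite addnK mulKn //; set n := (4 * m + 1)%N.
have n0 : (0 < n)%N by rewrite /n addn1.
have n_odd : odd n by rewrite /n oddD oddM.
have [w [v []]] := pochhammer_ratio_integral m; rewrite -/n => w_co vE.
have [b [w' [w'_co bE]]] := even_pochhammer_ratio_integral m n_odd.
(* Two embeddings are used: Q[q] into Q(q) for specializing [a], and Q[q][a] into its fraction field
   for the congruence itself. *)
have t_inj : injective (@FracField.tofrac {poly rat}).
  by move=> x y /eqP; rewrite tofrac_eq => /eqP.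
have f_inj : injective (@FracField.tofrac {poly {poly rat}}).
  by move=> x y /eqP; rewrite tofrac_eq => /eqP.
have [s [p pE]] := numer_diff_factor vE bE t_inj.
have X_co : coprimep 'X (1 - 'X^n : {poly rat}).
  apply: coprimep_subr1_Xn => z; rewrite map_polyX hornerX; apply: contra_eqN => /eqP ->.
  by rewrite expr0n gtn_eqF // eq_sym oner_neq0.
have d_co : coprimep ('X^s * (w ^+ 2 * w' * 'X^m)) (1 - 'X^n).
  by rewrite !coprimepMl w_co w'_co !coprimep_expl.
have nz_co (u : {poly rat}) : coprimep u (1 - 'X^n) -> u != 0.
  apply: contraTneq => ->; rewrite coprime0p -size_poly_eq1 -opprB size_polyN.
  by rewrite size_XnsubC // eqSS gtn_eqF.
have P_E : (\sum_(i < n) qP ^+ i) * (1 - aP * qP ^+ n) * (aP - qP ^+ n) = (qnum 'X n)%:P * pole qP aP n.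
  by rewrite (rmorph_qnum polyC) -mulrA.
rewrite P_E; exists (('X^s)%:P * numer_diff m w w' b v), (('X^s * (w ^+ 2 * w' * 'X^m))%:P * poles m).
split; [|split; [|split]].
- rewrite mulf_neq0 ?polyC_eq0 ?nz_co //; apply/prodf_neq0 => i _; exact: pole_qPaP_neq0.
- apply: coprimeR_poles t_inj _ _ _ n_odd (nz_co _ d_co) _.
  by apply: coprimep_dvdl d_co; rewrite -qnumE dvdp_mulIr.
- pose f : {rmorphism {poly {poly rat}} -> {fraction {poly {poly rat}}}} := @FracField.tofrac _.
  apply: etrans _ (@numer_diff_frac _ _ _ _ _ vE bE _ f s f_inj (nz_co _ w_co) (nz_co _ w'_co)).
  rewrite /qpoch /qint !prod_qpoch; congr (_ - _).
  apply: wp_sum_qpoch.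
  by rewrite /aF /toF tofrac_eq0 polyX_eq0.
- by exists p; rewrite pE.
Qed.
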